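(* Let $(A,R,\kappa)$ be an $XC$-algebra, $\varphi\in A$ a twisting element, and $\check R=(1\otimes\varphi^{-1})R(\varphi\otimes1)$ the twisted $R$-matrix. Let $B_N$ be a braid on $N$ strands with induced permutation $\sigma$, and let $Z_A(B_N),\check Z_A(B_N)\in A^{\otimes N}$ be the universal invariants of $B_N$ associated with $(A,R,\kappa)$ and $(A,\check R,\kappa)$ respectively. Then $\sigma_*\circ\check Z_A(B_N)$ is related to $\sigma_*\circ Z_A(B_N)$ by conjugation with $1\otimes\varphi\otimes\cdots\otimes\varphi^{N-1}$; that is, with $g=1\otimes\varphi\otimes\varphi^2\otimes\cdots\otimes\varphi^{N-1}$, $$\sigma_*\circ\check Z_A(B_N)=g\,\big(\sigma_*\circ Z_A(B_N)\big)\,g^{-1}.$$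
   Context: **$XC$-algebra.** Let $k$ be a commutative unital ring and $(A,\mu,1)$ a $k$-algebra. An $XC$-structure on $A$ consists of invertible elements $R\in A\otimes A$ (universal $R$-matrix) and $\kappa\in A$ (balancing element) such that: (1) $R^{\pm1}=(\kappa\otimes\kappa)R^{\pm1}(\kappa^{-1}\otimes\kappa^{-1})$; (2) $\mu^{[3]}(R_{31}\cdot\kappa_2)=\mu^{[3]}(R_{13}\cdot\kappa_2^{-1})$; (3) $1\otimes\kappa^{-1}=(\mu\otimes\mu^{[3]})(R_{15}\cdot R_{23}^{-1}\cdot\kappa_4^{-1})$; (4) $\kappa\otimes1=(\mu^{[3]}\otimes\mu)(R_{15}^{-1}\cdot R_{34}\cdot\kappa_2)$; (5) $R_{12}R_{13}R_{23}=R_{23}R_{13}R_{12}$. Here $\mu^{[3]}$ is the three-fold multiplication; writing $R=\sum_i\alpha_i\otimes\beta_i$, $R_{ij}$ has first leg $\alpha$ in the $i$-th tensor factor, second leg $\beta$ in the $j$-th, and $1$ elsewhere (similarly for $R^{-1}$), and $\kappa_i^{\pm1}$ is $\kappa^{\pm1}$ in the $i$-th factor. **Twisting element.** An invertible $\varphi\in A$ with $[\varphi,\kappa]=0$ and $[\varphi\otimes\varphi,R]=0$. The triple $(A,\check R,\kappa)$ is again an $XC$-algebra. **Universal invariant of a braid.** Strands of $B_N$ are oriented upwards; strand $j$ is the one starting at the $j$-th bottom position, and ends at position $\sigma(j)$. With $R=\sum\alpha_i\otimes\beta_i$, $R^{-1}=\sum\bar\alpha_i\otimes\bar\beta_i$,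 place $\alpha_i$ on the overstrand and $\beta_i$ on the understrand of each positive crossing, and $\bar\alpha_i$ on the overstrand and $\bar\beta_i$ on the understrand of each negative crossing. A positive crossing has its overstrand going from bottom left to top right. The $j$-th tensor factor of $Z_A(B_N)$ is the product of the beads on strand $j$, written from right to left along the orientation, and one sums over all indices. $\check Z_A$ is defined in the same way with $\check R$ in place of $R$. **$\sigma_*$.** $\sigma_*$ permutes tensor factors, sending the factor $j$ to position $\sigma(j)$. The composite $\sigma_*\circ x$, for $x\in A^{\otimes N}$, is understood as an operator (multiply/act by $x$, then permute), equivalently as an element of the semidirect (smash) product of $A^{\otimes N}$ with the symmetric group $S_N$, where $\sigma_*\,x\,\sigma_*^{-1}=\sigma_*(x)$. *)

(* Defs.v *)
From HB Require Import structures.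
From mathcomp Require Import all_boot all_order all_algebra all_fingroup.
From mathcomp Require Import generic_quotient boolp zify.

Set Implicit Arguments.
Unset Strict Implicit.
Unset Printing Implicit Defensive.
Import GRing.Theory.
Local Open Scope quotient_scope.
Local Open Scope ring_scope.

(* The tensor powers A^{(x)N} of a k-algebra A over a commutative ring k,     *)
(* as a quotient of the formal k-linear combinations of N-tuples of A.        *)

Section FormalSums.
Variables (k : comPzRingType) (A : algType k) (N : nat).

(* a formal sum of terms c (a_0, ..., a_{N-1}) *)
Definition fsum := seq (k * {ffun 'I_N -> A}).

Definition upd (a : {ffun 'I_N -> A}) (i : 'I_N) (x : A) : {ffun 'I_N -> A} :=
  [ffun j => if j == i then x else a j].

Definition multilinear (V : lmodType k) (f : {ffun 'I_N -> A} -> V) : Prop :=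
  forall a i c x y,
    f (upd a i (c *: x + y)) = c *: f (upd a i x) + f (upd a i y).

(* tens_zero, tens_add and tens_catC present the free k-module on N-tuples,   *)
(* and tens_slot the relations making the tuple multilinear.                  *)
Inductive tens_rel : fsum -> fsum -> Prop :=
| tens_refl s : tens_rel s s
| tens_sym s t : tens_rel s t -> tens_rel t s
| tens_trans s t u : tens_rel s t -> tens_rel t u -> tens_rel s u
| tens_cat s s' t t' :
    tens_rel s s' -> tens_rel t t' -> tens_rel (s ++ t) (s' ++ t')
| tens_catC s t : tens_rel (s ++ t) (t ++ s)
| tens_zero a : tens_rel [:: (0, a)] [::]
| tens_add c d a : tens_rel [:: (c + d, a)] [:: (c, a); (d, a)]
| tens_slot c d a i x y :
    tens_rel [:: (c, upd a i (d *: x + y))]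
             [:: (c * d, upd a i x); (c, upd a i y)].

Definition tens_relb (s t : fsum) : bool := `[< tens_rel s t >].

Lemma tens_relb_equiv : equiv_class_of tens_relb.
Proof.
split=> [s | s t | t s u].
- by apply/asboolP; apply: tens_refl.
- by apply/asboolP/asboolP => h; apply: tens_sym.
- by move=> /asboolP h1 /asboolP h2; apply/asboolP; apply: tens_trans h1 h2.
Qed.

Canonical tens_equiv : equiv_rel fsum := EquivRelPack tens_relb_equiv.

Definition tpow : Type := {eq_quot tens_equiv}.

HB.instance Definition _ := Choice.on tpow.
HB.instance Definition _ := EqQuotient.on tpow.

Local Notation PI := (\pi_tpow).

Lemma tpiP (s t : fsum) : PI s = PI t <-> tens_rel s t.
Proof.
split; first by move/eqmodP/asboolP.
by move=> h; apply/eqmodP; apply/asboolP.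
Qed.

Lemma tpow_ind (P : tpow -> Prop) : (forall s, P (PI s)) -> forall x, P x.
Proof. by move=> h x; rewrite -[x]reprK. Qed.

Definition fscale (c : k) (s : fsum) : fsum := [seq (c * p.1, p.2) | p <- s].

Lemma fscale_rel c s t : tens_rel s t -> tens_rel (fscale c s) (fscale c t).
Proof.
elim=> {s t} /=.
- by move=> s; apply: tens_refl.
- by move=> s t _ h; apply: tens_sym.
- by move=> s t u _ h1 _ h2; apply: tens_trans h1 h2.
- by move=> s s' t t' _ h1 _ h2; rewrite /fscale !map_cat; apply: tens_cat.
- by move=> s t; rewrite /fscale !map_cat; apply: tens_catC.
- by move=> a; rewrite mulr0; apply: tens_zero.
- by move=> d e a; rewrite mulrDr; apply: tens_add.
- by move=> d e a i x y; rewrite mulrA; apply: tens_slot.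
Qed.

Lemma fscale0_rel s : tens_rel (fscale 0 s) [::].
Proof.
elim: s => [|[c a] s IH] /=; first exact: tens_refl.
rewrite mul0r -cat1s -[X in tens_rel _ X]cats0.
by apply: tens_cat => //; apply: tens_zero.
Qed.

Lemma fscaleD_rel c d s : tens_rel (fscale (c + d) s) (fscale c s ++ fscale d s).
Proof.
elim: s => [|[e a] s IH] /=; first exact: tens_refl.
rewrite mulrDl -cat1s.
apply: (tens_trans (tens_cat (tens_add _ _ _) IH)).
rewrite -(cat1s (c * e, a) (fscale c s ++ _)) -(cat1s (c * e, a) [:: _]) -!catA.
apply: tens_cat; first exact: tens_refl.
rewrite -(cat1s _ (fscale d s)) !catA; apply: tens_cat; last exact: tens_refl.
exact: tens_catC.
Qed.

Definition tadd (x y : tpow) : tpow := PI (repr x ++ repr y).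
Definition tscale (c : k) (x : tpow) : tpow := PI (fscale c (repr x)).

Lemma repr_rel s : tens_rel (repr (PI s)) s.
Proof. by apply/tpiP; rewrite reprK. Qed.

Lemma taddE s t : tadd (PI s) (PI t) = PI (s ++ t).
Proof. by apply/tpiP; apply: tens_cat; apply: repr_rel. Qed.

Lemma tscaleE c s : tscale c (PI s) = PI (fscale c s).
Proof. by apply/tpiP; apply: fscale_rel; apply: repr_rel. Qed.

Lemma taddA : associative tadd.
Proof.
by elim/tpow_ind=> x; elim/tpow_ind=> y; elim/tpow_ind=> z; rewrite !taddE catA.
Qed.

Lemma taddC : commutative tadd.
Proof.
elim/tpow_ind=> x; elim/tpow_ind=> y; rewrite !taddE; apply/tpiP.
exact: tens_catC.
Qed.

Lemma tadd0 : left_id (PI [::]) tadd.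
Proof. by elim/tpow_ind=> x; rewrite taddE. Qed.

Lemma fscale1 s : fscale 1 s = s.
Proof. by elim: s => //= -[c a] s ->; rewrite mul1r. Qed.

Lemma taddN : left_inverse (PI [::]) (tscale (- 1)) tadd.
Proof.
elim/tpow_ind=> x; rewrite tscaleE taddE; apply/tpiP.
rewrite -[X in _ ++ X]fscale1.
apply: (tens_trans (tens_sym (fscaleD_rel _ _ _))).
by rewrite addNr; apply: fscale0_rel.
Qed.

HB.instance Definition _ := GRing.isZmodule.Build tpow taddA taddC tadd0 taddN.

Lemma addpiE s t : PI s + PI t = PI (s ++ t).
Proof. exact: taddE. Qed.

Lemma tscaleA c d x : tscale c (tscale d x) = tscale (c * d) x.
Proof.
elim/tpow_ind: x => x; rewrite !tscaleE /fscale -map_comp; congr (PI _).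
by apply: eq_map => p /=; rewrite mulrA.
Qed.

Lemma tscale1 : left_id 1 tscale.
Proof. by elim/tpow_ind=> x; rewrite tscaleE fscale1. Qed.

Lemma tscaleDr : right_distributive tscale +%R.
Proof.
move=> c; elim/tpow_ind=> x; elim/tpow_ind=> y.
by rewrite addpiE !tscaleE addpiE /fscale map_cat.
Qed.

Lemma tscaleDl x : {morph tscale^~ x : c d / c + d}.
Proof.
elim/tpow_ind: x => x c d; rewrite !tscaleE addpiE; apply/tpiP.
exact: fscaleD_rel.
Qed.

HB.instance Definition _ :=
  GRing.Zmodule_isLmodule.Build k tpow tscaleA tscale1 tscaleDr tscaleDl.

Lemma scalepiE c s : c *: PI s = PI (fscale c s).
Proof. exact: tscaleE. Qed.

(* the pure tensor a_0 (x) ... (x) a_{N-1} *)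
Definition tens (a : 'I_N -> A) : tpow := PI [:: (1, finfun a)].

Lemma eq_tens a b : a =1 b -> tens a = tens b.
Proof. by move=> h; congr (PI [:: (1, _)]); apply/ffunP=> i; rewrite !ffunE. Qed.

Lemma tensE s : PI s = \sum_(p <- s) p.1 *: tens p.2.
Proof.
elim: s => [|[c a] s IH]; first by rewrite big_nil.
rewrite big_cons -IH -cat1s -addpiE; congr (_ + _) => /=.
rewrite /tens scalepiE /= mulr1; congr (PI [:: (_, _)]).
by apply/ffunP=> i; rewrite ffunE.
Qed.

Lemma tens_multilinear : multilinear (fun a => tens a).
Proof.
move=> a i c x y; rewrite /tens scalepiE addpiE; apply/tpiP => /=.
have fK (b : {ffun 'I_N -> A}) : [ffun x => b x] = b.
  by apply/ffunP=> j; rewrite ffunE.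
rewrite !fK mulr1 -[c in [:: (c, _); _]]mul1r; exact: tens_slot.
Qed.

(* The linear extension of f to A^{(x)N}.  It is total, and meaningful for    *)
(* multilinear f, by tlift_tens.                                              *)
Definition tlift (V : lmodType k) (f : {ffun 'I_N -> A} -> V) (x : tpow) : V :=
  \sum_(p <- repr x) p.1 *: f p.2.

Section Lift.
Variables (V : lmodType k) (f : {ffun 'I_N -> A} -> V).
Hypothesis fM : multilinear f.

Lemma feval_rel s t : tens_rel s t ->
  \sum_(p <- s) p.1 *: f p.2 = \sum_(p <- t) p.1 *: f p.2.
Proof.
elim=> {s t} //.
- by move=> s t u _ -> _ ->.
- by move=> s s' t t' _ h1 _ h2; rewrite !big_cat /= h1 h2.
- by move=> s t; rewrite !big_cat /= addrC.
- by move=> a; rewrite big_seq1 big_nil scale0r.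
- by move=> c d a; rewrite big_seq1 !big_cons big_nil /= addr0 scalerDl.
- move=> c d a i x y.
  by rewrite big_seq1 !big_cons big_nil /= addr0 fM scalerDr scalerA.
Qed.

Lemma tliftE s : tlift f (PI s) = \sum_(p <- s) p.1 *: f p.2.
Proof. exact: feval_rel (repr_rel s). Qed.

Lemma tlift_tens a : tlift f (tens a) = f (finfun a).
Proof. by rewrite tliftE big_seq1 scale1r. Qed.

Lemma tlift_linear : linear (tlift f).
Proof.
move=> c; elim/tpow_ind=> x; elim/tpow_ind=> y.
rewrite scalepiE addpiE !tliftE big_cat /=; congr (_ + _).
rewrite big_map scaler_sumr; apply: eq_bigr => p _ /=.
by rewrite scalerA.
Qed.

End Lift.

Lemma tens_ind (P : tpow -> Prop) :
  P 0 -> (forall c x y, P x -> P y -> P (c *: x + y)) ->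
  (forall a, P (tens a)) -> forall x, P x.
Proof.
move=> P0 PD Pt; elim/tpow_ind=> s; rewrite tensE.
by elim: s => [|p s IH]; rewrite ?big_nil // big_cons; apply: PD.
Qed.

Lemma tens_ext (V : lmodType k) (f g : tpow -> V) :
  linear f -> linear g -> (forall a, f (tens a) = g (tens a)) -> f =1 g.
Proof.
move=> fL gL h; apply: tens_ind => [|c x y hx hy|//].
- have f0 (u : tpow -> V) : linear u -> u 0 = 0.
    by move=> uL; have := uL (- 1) 0 0; rewrite scaler0 addr0 scaleN1r addNr.
  by rewrite !f0.
- by rewrite fL gL hx hy.
Qed.

(* A^{(x)N} is a k-algebra for the factorwise multiplication *)

Definition tmul (x y : tpow) : tpow :=
  tlift (fun a => tlift (fun b => tens (fun i => a i * b i)) y) x.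
Definition tone : tpow := tens (fun=> 1).

Lemma tmul_multilinear_r a :
  multilinear (fun b : {ffun 'I_N -> A} => tens (fun i => a i * b i)).
Proof.
move=> b i c x y /=.
have E z : tens (fun j => a j * upd b i z j) =
           tens (upd [ffun j => a j * b j] i (a i * z)).
  by apply: eq_tens => j; rewrite !ffunE; case: eqP => // ->.
by rewrite !E mulrDr -scalerAr tens_multilinear.
Qed.

Lemma tmul_multilinear_l (y : tpow) :
  multilinear (fun a : {ffun 'I_N -> A} =>
    tlift (fun b => tens (fun i => a i * b i)) y).
Proof.
move=> a i c u v /=; elim/tpow_ind: y => y.
rewrite !(tliftE (tmul_multilinear_r _)) scaler_sumr -big_split /=.
apply: eq_bigr => -[d b] _ /=.
have E z : tens (fun j => upd a i z j * b j) =
           tens (upd [ffun j => a j * b j] i (z * b i)).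
  by apply: eq_tens => j; rewrite !ffunE; case: eqP => // ->.
rewrite !E mulrDl -scalerAl tens_multilinear scalerDr !scalerA.
by rewrite mulrC.
Qed.

Lemma tmul_tens a b : tmul (tens a) (tens b) = tens (fun i => a i * b i).
Proof.
rewrite /tmul (tlift_tens (tmul_multilinear_l _)).
rewrite (tlift_tens (tmul_multilinear_r _)).
by apply: eq_tens => i; rewrite !ffunE.
Qed.

Lemma tmul_linear_l y : linear (tmul^~ y).
Proof. exact: tlift_linear (tmul_multilinear_l y). Qed.

Lemma tmul_linear_r x : linear (tmul x).
Proof.
move=> c u v; elim/tpow_ind: x => x.
rewrite /tmul !(tliftE (tmul_multilinear_l _)) scaler_sumr -big_split /=.
apply: eq_bigr => -[d a] _ /=.
rewrite (tlift_linear (tmul_multilinear_r _)) scalerDr !scalerA.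
by rewrite mulrC.
Qed.

Lemma tmulA : associative tmul.
Proof.
move=> x y z; move: x.
apply: (@tens_ext _ (tmul^~ (tmul y z)) (fun x => tmul (tmul x y) z)).
- exact: tmul_linear_l.
- by move=> c u v; rewrite !tmul_linear_l.
move=> a; move: y.
apply: (@tens_ext _ (fun y => tmul _ (tmul y z)) (fun y => tmul (tmul _ y) z)).
- by move=> c u v; rewrite tmul_linear_l tmul_linear_r.
- by move=> c u v; rewrite tmul_linear_r tmul_linear_l.
move=> b; move: z.
apply: (@tens_ext _ (fun z => tmul _ (tmul _ z)) (fun z => tmul (tmul _ _) z)).
- by move=> c u v; rewrite !tmul_linear_r.
- by move=> c u v; rewrite !tmul_linear_r.
by move=> c; rewrite !tmul_tens; apply: eq_tens => i; rewrite mulrA.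
Qed.

Lemma tmul1 : left_id tone tmul.
Proof.
apply: (@tens_ext _ (tmul tone) id) => [||a]; first exact: tmul_linear_r.
- by [].
- by rewrite tmul_tens; apply: eq_tens => i; rewrite mul1r.
Qed.

Lemma tmulr1 : right_id tone tmul.
Proof.
apply: (@tens_ext _ (tmul^~ tone) id) => [||a]; first exact: tmul_linear_l.
- by [].
- by rewrite tmul_tens; apply: eq_tens => i; rewrite mulr1.
Qed.

Lemma tmulDl : left_distributive tmul +%R.
Proof. by move=> x y z; have := tmul_linear_l z 1 x y; rewrite !scale1r. Qed.

Lemma tmulDr : right_distributive tmul +%R.
Proof. by move=> x y z; have := tmul_linear_r x 1 y z; rewrite !scale1r. Qed.

Lemma tprod_multilinear :
  @multilinear A (fun a => \prod_(i < N) a i).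
Proof.
move=> a i c x y; have : i \in index_enum 'I_N by exact: mem_index_enum.
have : uniq (index_enum 'I_N) by exact: index_enum_uniq.
elim: (index_enum _) => //= j r IH /andP[jr ur].
have E z : i \notin r -> \prod_(l <- r) upd a i z l = \prod_(l <- r) a l.
  move=> ir; apply: eq_big_seq => l lr; rewrite ffunE; case: eqP => // li.
  by rewrite -li lr in ir.
rewrite inE !big_cons; case: eqVneq => [ij | ij] /= ir.
  have {}E z : \prod_(l <- r) upd a i z l = \prod_(l <- r) a l.
    by apply: E; rewrite ij.
  by rewrite !E !ffunE ij eqxx mulrDl scalerAl.
have jF z : upd a i z j = a j by rewrite ffunE eq_sym (negbTE ij).
by rewrite !jF IH // mulrDr scalerAr.
Qed.

Lemma tone_neq0 : tone != 0.
Proof.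
apply/eqP => h; have fM := tprod_multilinear.
have f0 : tlift (fun a : {ffun 'I_N -> A} => \prod_(i < N) a i) 0 = 0.
  have := tlift_linear fM (- 1) 0 0.
  by rewrite scaler0 addr0 scaleN1r addNr.
have := tlift_tens fM (fun=> 1); rewrite -/tone h f0.
rewrite big1 => [h0 | i _]; last by rewrite ffunE.
by have := oner_neq0 A; rewrite -h0 eqxx.
Qed.

HB.instance Definition _ := GRing.Zmodule_isNzRing.Build tpow
  tmulA tmul1 tmulr1 tmulDl tmulDr tone_neq0.

Lemma tscalerAl (c : k) (x y : tpow) : c *: (x * y) = (c *: x) * y.
Proof.
have := tmul_linear_l y c x 0; rewrite /= -[tmul 0 y]/(0 * y) mul0r !addr0.
by move=> h; apply/esym.
Qed.

HB.instance Definition _ := GRing.Lmodule_isLalgebra.Build k tpow tscalerAl.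

Lemma tscalerAr (c : k) (x y : tpow) : c *: (x * y) = x * (c *: y).
Proof.
have := tmul_linear_r x c y 0; rewrite -[tmul x 0]/(x * 0) mulr0 !addr0.
by move=> h; apply/esym.
Qed.

HB.instance Definition _ := GRing.Lalgebra_isAlgebra.Build k tpow tscalerAr.

Lemma tensM a b : tens a * tens b = tens (fun i => a i * b i).
Proof. exact: tmul_tens. Qed.

Lemma tens1 : tens (fun=> 1) = 1.
Proof. by []. Qed.

End FormalSums.

Definition tens2 (k : comPzRingType) (A : algType k) (x y : A) : tpow A 2 :=
  tens (tnth [tuple x; y]).

(* place s sends a_0 (x) ... (x) a_{m-1} to the pure tensor with a_p in       *)
(* factor s p, and 1 in the remaining factors; it is used for injective s.    *)
Definition place (k : comPzRingType) (A : algType k) (m N : nat)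
    (s : 'I_m -> 'I_N) : tpow A m -> tpow A N :=
  tlift (fun a => tens (fun l => if [pick p | s p == l] is Some p
                                 then a p else 1)).

(* R_{ij} *)
Definition leg (k : comPzRingType) (A : algType k) (N : nat) (i j : 'I_N) :
    tpow A 2 -> tpow A N :=
  place (tnth [tuple i; j]).

(* x in factor i *)
Definition slot (k : comPzRingType) (A : algType k) (N : nat) (i : 'I_N)
    (x : A) : tpow A N :=
  tens (fun l => if l == i then x else 1).

(* sigma_*, sending the factor j to position sigma j *)
Definition perm_factors (k : comPzRingType) (A : algType k) (N : nat)
    (sigma : 'S_N) : tpow A N -> tpow A N :=
  place sigma.

Section Place.
Variables (k : comPzRingType) (A : algType k).

Section Place1.
Variables (m N : nat) (s : 'I_m -> 'I_N).
Hypothesis s_inj : injective s.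

Let pl (a : 'I_m -> A) (l : 'I_N) : A :=
  if [pick p | s p == l] is Some p then a p else 1.

Lemma place_multilinear :
  multilinear (fun a : {ffun 'I_m -> A} => tens (pl a)).
Proof.
move=> a p c x y.
have E z : tens (pl (upd a p z)) = tens (upd (finfun (pl a)) (s p) z).
  apply: eq_tens => l; rewrite /pl !ffunE; case: pickP => [q /eqP <- | ne].
    by rewrite ffunE (inj_eq s_inj).
  by rewrite eq_sym ne.
by rewrite !E tens_multilinear.
Qed.

Lemma place_tens a : place s (tens a) = tens (pl a).
Proof.
rewrite /place (tlift_tens place_multilinear); apply: eq_tens => l.
by rewrite /pl; case: pickP => // p _; rewrite ffunE.
Qed.

Lemma place_linear : linear (@place k A m N s).
Proof. exact: tlift_linear place_multilinear. Qed.

Lemma place1 : place s 1 = 1 :> tpow A N.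
Proof.
by rewrite -!tens1 place_tens; apply: eq_tens => l; rewrite /pl; case: pickP.
Qed.

Lemma placeM : {morph @place k A m N s : x y / x * y}.
Proof.
move=> x y; move: x.
apply: (@tens_ext _ _ _ _ (fun x => place s (x * y))
                          (fun x => place s x * place s y)).
- by move=> c u v; rewrite mulrDl -scalerAl place_linear.
- by move=> c u v; rewrite place_linear mulrDl -scalerAl.
move=> a; move: y.
apply: (@tens_ext _ _ _ _ (fun y => place s (_ * y))
                          (fun y => place s _ * place s y)).
- by move=> c u v; rewrite mulrDr -scalerAr place_linear.
- by move=> c u v; rewrite place_linear mulrDr -scalerAr.
move=> b; rewrite tensM !place_tens tensM; apply: eq_tens => l.
by rewrite /pl; case: pickP => // _; rewrite mulr1.
Qed.

End Place1.

Lemma eq_place m N (s t : 'I_m -> 'I_N) : s =1 t -> @place k A m N s =1 place t.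
Proof.
move=> st x; apply: eq_bigr => p _; congr (_ *: _); apply: eq_tens => l.
by rewrite (eq_pick (Q := fun p => t p == l)) // => q; rewrite st.
Qed.

Lemma place_comp m n N (s : 'I_n -> 'I_N) (t : 'I_m -> 'I_n) :
  injective s -> injective t ->
  forall x : tpow A m, place s (place t x) = place (s \o t) x.
Proof.
move=> si ti; have sti := inj_comp si ti; apply: tens_ext.
- by move=> c u v; rewrite !place_linear.
- exact: place_linear.
move=> a; rewrite !place_tens //; apply: eq_tens => l.
case: pickP => [q /eqP <- | ne]; last first.
  by case: pickP => // p /=; rewrite ne.
by congr (if _ is Some p then a p else 1); apply: eq_pick => p; rewrite /= inj_eq.
Qed.

Lemma place_comm m n N (s : 'I_m -> 'I_N) (t : 'I_n -> 'I_N) :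
  injective s -> injective t -> (forall p q, s p != t q) ->
  forall (x : tpow A m) (y : tpow A n),
    place s x * place t y = place t y * place s x.
Proof.
move=> si ti st x y; move: x.
apply: (@tens_ext _ _ _ _ (fun x => place s x * place t y)
                          (fun x => place t y * place s x)).
- by move=> c u v; rewrite place_linear // mulrDl -scalerAl.
- by move=> c u v; rewrite place_linear // mulrDr -scalerAr.
move=> a; move: y.
apply: (@tens_ext _ _ _ _ (fun y => place s _ * place t y)
                          (fun y => place t y * place s _)).
- by move=> c u v; rewrite place_linear // mulrDr -scalerAr.
- by move=> c u v; rewrite place_linear // mulrDl -scalerAl.
move=> b; rewrite !place_tens // !tensM; apply: eq_tens => l.
case: pickP => [p /eqP <- | _]; last by rewrite mul1r mulr1.
by case: pickP => [q /eqP E | _]; rewrite ?mul1r ?mulr1 //; have := st p q; rewrite E eqxx.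
Qed.

Lemma tnth2_inj N (i j : 'I_N) : i != j -> injective (tnth [tuple i; j]).
Proof. by move=> ij; apply/tuple_uniqP; rewrite /= inE ij. Qed.

Lemma tnth3_inj N (i j l : 'I_N) :
  i != j -> i != l -> j != l -> injective (tnth [tuple i; j; l]).
Proof.
by move=> ij il jl; apply/tuple_uniqP; rewrite /= !inE negb_or ij il jl.
Qed.

End Place.

Record invertible (B : pzRingType) := Invertible {
  uval : B;
  uinv : B;
  uvalK : uval * uinv = 1;
  uinvK : uinv * uval = 1 }.

(* pos N i is the i-th of N tensor factors, counted from 1. *)
Local Notation pos N i := (@Ordinal N i.-1 isT) (only parsing).

Section XC.
Variables (k : comPzRingType) (A : algType k).

(* mu^{[3]} : A^{(x)3} -> A *)
Definition mu3 : tpow A 3 -> A :=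
  tlift (fun a : {ffun 'I_3 -> A} => a (pos 3 1) * a (pos 3 2) * a (pos 3 3)).

(* mu (x) mu^{[3]} and mu^{[3]} (x) mu *)
Definition mu_mu3 : tpow A 5 -> tpow A 2 :=
  tlift (fun a : {ffun 'I_5 -> A} => tens2 (a (pos 5 1) * a (pos 5 2))
                        (a (pos 5 3) * a (pos 5 4) * a (pos 5 5))).
Definition mu3_mu : tpow A 5 -> tpow A 2 :=
  tlift (fun a : {ffun 'I_5 -> A} => tens2 (a (pos 5 1) * a (pos 5 2) * a (pos 5 3))
                        (a (pos 5 4) * a (pos 5 5))).

Definition YBE (R : tpow A 2) : Prop :=
  leg (pos 3 1) (pos 3 2) R * leg (pos 3 1) (pos 3 3) R * leg (pos 3 2) (pos 3 3) R =
  leg (pos 3 2) (pos 3 3) R * leg (pos 3 1) (pos 3 3) R * leg (pos 3 1) (pos 3 2) R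
    :> tpow A 3.

Record XC_structure (R : invertible (tpow A 2)) (kappa : invertible A) : Prop :=
  XCStructure {
    xc_kappa_R :
      uval R = tens2 (uval kappa) (uval kappa) * uval R * tens2 (uinv kappa) (uinv kappa);
    xc_kappa_Rinv :
      uinv R = tens2 (uval kappa) (uval kappa) * uinv R * tens2 (uinv kappa) (uinv kappa);
    xc_mu3 :
      mu3 (leg (pos 3 3) (pos 3 1) (uval R) * slot (pos 3 2) (uval kappa)) =
      mu3 (leg (pos 3 1) (pos 3 3) (uval R) * slot (pos 3 2) (uinv kappa));
    xc_mu_mu3 :
      tens2 1 (uinv kappa) =
      mu_mu3 (leg (pos 5 1) (pos 5 5) (uval R) * leg (pos 5 2) (pos 5 3) (uinv R)
              * slot (pos 5 4) (uinv kappa));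
    xc_mu3_mu :
      tens2 (uval kappa) 1 =
      mu3_mu (leg (pos 5 1) (pos 5 5) (uinv R) * leg (pos 5 3) (pos 5 4) (uval R)
              * slot (pos 5 2) (uval kappa));
    xc_YBE : YBE (uval R) }.

Definition twisting (R : invertible (tpow A 2)) (kappa phi : invertible A) :
    Prop :=
  uval phi * uval kappa = uval kappa * uval phi /\
  tens2 (uval phi) (uval phi) * uval R = uval R * tens2 (uval phi) (uval phi).

Lemma tens2M (x y x' y' : A) :
  tens2 x y * tens2 x' y' = tens2 (x * x') (y * y').
Proof.
rewrite /tens2 tensM; apply: eq_tens => l.
by rewrite !(tnth_nth 0) /=; case: l => [[|[|]]].
Qed.

Lemma tens2_1 : tens2 1 1 = 1 :> tpow A 2.
Proof.
rewrite -tens1; apply: eq_tens => l.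
by rewrite (tnth_nth 0) /=; case: l => [[|[|]]].
Qed.

Section Twist.
Variables (R : invertible (tpow A 2)) (phi : invertible A).

Definition twist_val : tpow A 2 := tens2 1 (uinv phi) * uval R * tens2 (uval phi) 1.
Definition twist_inv : tpow A 2 :=
  tens2 (uinv phi) 1 * uinv R * tens2 1 (uval phi).

Lemma twist_valK : twist_val * twist_inv = 1.
Proof.
rewrite /twist_val /twist_inv -!mulrA (mulrA (tens2 _ 1)) tens2M uvalK mulr1.
rewrite tens2_1 mul1r (mulrA (uval R)) uvalK mul1r tens2M mulr1 uinvK.
exact: tens2_1.
Qed.

Lemma twist_invK : twist_inv * twist_val = 1.
Proof.
rewrite /twist_val /twist_inv -!mulrA (mulrA (tens2 1 _)) tens2M uvalK mulr1.
rewrite tens2_1 mul1r (mulrA (uinv R)) uinvK mul1r tens2M mulr1 uinvK.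
exact: tens2_1.
Qed.

(* the twisted R-matrix (1 (x) phi^-1) R (phi (x) 1) *)
Definition twist : invertible (tpow A 2) := Invertible twist_valK twist_invK.

End Twist.

(* g = 1 (x) phi (x) phi^2 (x) ... (x) phi^{N-1} *)
Section TwistPowers.
Variables (phi : invertible A) (N : nat).

Lemma uvalXK n : uval phi ^+ n * uinv phi ^+ n = 1.
Proof.
rewrite -exprMn_comm ?uvalK ?expr1n //.
by rewrite /GRing.comm uvalK uinvK.
Qed.

Lemma uinvXK n : uinv phi ^+ n * uval phi ^+ n = 1.
Proof.
rewrite -exprMn_comm ?uinvK ?expr1n //.
by rewrite /GRing.comm uvalK uinvK.
Qed.

Lemma twist_powersK :
  tens (fun j : 'I_N => uval phi ^+ j) * tens (fun j => uinv phi ^+ j) = 1.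
Proof. by rewrite tensM; apply: eq_tens => j; apply: uvalXK. Qed.

Lemma twist_powersVK :
  tens (fun j : 'I_N => uinv phi ^+ j) * tens (fun j => uval phi ^+ j) = 1.
Proof. by rewrite tensM; apply: eq_tens => j; apply: uinvXK. Qed.

Definition twist_powers : invertible (tpow A N) :=
  Invertible twist_powersK twist_powersVK.

End TwistPowers.

End XC.

(* Braid words are read from the bottom of the braid to its top.  The letter  *)
(* (true, i) is the positive crossing of positions i and i+1 (overstrand from *)
(* bottom left to top right), and (false, i) the negative one (overstrand     *)
(* from bottom right to top left).                                            *)
Section Braids.
Variable N : nat.

Definition braid_word := seq (bool * 'I_N.-1).

(* the Artin presentation of the braid group *)
Inductive braid_rel : braid_word -> braid_word -> Prop :=
| braid_refl v : braid_rel v v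
| braid_sym v w : braid_rel v w -> braid_rel w v
| braid_trans u v w : braid_rel u v -> braid_rel v w -> braid_rel u w
| braid_cat v v' w w' :
    braid_rel v v' -> braid_rel w w' -> braid_rel (v ++ w) (v' ++ w')
| braid_cancel b i : braid_rel [:: (b, i); (~~ b, i)] [::]
| braid_far (i j : 'I_N.-1) : (i.+1 < j)%N ->
    braid_rel [:: (true, i); (true, j)] [:: (true, j); (true, i)]
| braid_braid (i j : 'I_N.-1) : j = i.+1 :> nat ->
    braid_rel [:: (true, i); (true, j); (true, i)]
              [:: (true, j); (true, i); (true, j)].

Definition braid_relb (v w : braid_word) : bool := `[< braid_rel v w >].

Lemma braid_relb_equiv : equiv_class_of braid_relb.
Proof.
split=> [s | s t | t s u].
- by apply/asboolP; apply: braid_refl.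
- by apply/asboolP/asboolP => h; apply: braid_sym.
- by move=> /asboolP h1 /asboolP h2; apply/asboolP; apply: braid_trans h1 h2.
Qed.

Canonical braid_equiv : equiv_rel braid_word := EquivRelPack braid_relb_equiv.

Definition braid : Type := {eq_quot braid_equiv}.

HB.instance Definition _ := Choice.on braid.
HB.instance Definition _ := EqQuotient.on braid.

Lemma braid_repr_rel w : braid_rel (repr (\pi_braid w)) w.
Proof.
have : repr (\pi_braid w) = w %[mod braid] by rewrite reprK.
by move/eqmodP/asboolP.
Qed.

Lemma left_pos_subproof (i : 'I_N.-1) : (i < N)%N.
Proof. exact: leq_trans (ltn_ord i) (leq_pred N). Qed.

Lemma right_pos_subproof (i : 'I_N.-1) : (i.+1 < N)%N.
Proof. by case: N i => [[]|n i] //=; rewrite ltnS. Qed.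

Definition left_pos (i : 'I_N.-1) : 'I_N := Ordinal (left_pos_subproof i).
Definition right_pos (i : 'I_N.-1) : 'I_N := Ordinal (right_pos_subproof i).

(* Permutations compose from left to right: (s * t) x = t (s x). *)
Definition word_perm (w : braid_word) : 'S_N :=
  (\prod_(x <- w) tperm (left_pos x.2) (right_pos x.2))%g.

(* the induced permutation sigma: strand j ends at position sigma j *)
Definition braid_perm (B : braid) : 'S_N := word_perm (repr B).

Variables (k : comPzRingType) (A : algType k) (R : invertible (tpow A 2)).

(* The beads of a crossing of strand a (on the left below it) with strand b:  *)
(* the first leg goes to the overstrand.                                      *)
Definition crossing (positive : bool) (a b : 'I_N) : tpow A N :=
  if positive then leg a b (uval R) else leg b a (uinv R).

(* The beads of w, where strand j enters w at position p j.  The product in   *)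
(* A^{(x)N} multiplies the beads strand by strand and sums over all indices;  *)
(* the beads met later are on the left.                                       *)
Fixpoint word_invariant (p : 'S_N) (w : braid_word) : tpow A N :=
  if w is (b, i) :: w' then
    word_invariant (p * tperm (left_pos i) (right_pos i))%g w' *
    crossing b ((p^-1)%g (left_pos i)) ((p^-1)%g (right_pos i))
  else 1.

(* Z_A.  When R satisfies the Yang-Baxter equation, the word representing the *)
(* braid is immaterial, by braid_invariant_pi.                                *)
Definition braid_invariant (B : braid) : tpow A N := word_invariant 1%g (repr B).

Lemma word_perm_cat v w : word_perm (v ++ w) = (word_perm v * word_perm w)%g.
Proof. by rewrite /word_perm big_cat. Qed.

Lemma word_invariant_cat p v w :
  word_invariant p (v ++ w) =
  word_invariant (p * word_perm v)%g w * word_invariant p v.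
Proof.
elim: v p => [|[b i] v IH] p /=.
  by rewrite /word_perm big_nil mulg1 mulr1.
by rewrite IH /word_perm big_cons mulgA mulrA.
Qed.

Lemma left_right_neq i : left_pos i != right_pos i.
Proof. by rewrite -val_eqE /= neq_ltn ltnSn. Qed.

Lemma far_neq (i j : 'I_N.-1) : (i.+1 < j)%N ->
  [/\ left_pos i != left_pos j, left_pos i != right_pos j,
      right_pos i != left_pos j & right_pos i != right_pos j].
Proof. by move=> ij; rewrite -!val_eqE /=; split; lia. Qed.

Lemma word_perm_rel v w : braid_rel v w -> word_perm v = word_perm w.
Proof.
elim=> {v w} //.
- by move=> u v w _ -> _ ->.
- by move=> v v' w w' _ h1 _ h2; rewrite !word_perm_cat h1 h2.
- by move=> b i; rewrite /word_perm !big_cons !big_nil mulg1 tperm2.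
- move=> i j /far_neq[h1 h2 h3 h4].
  rewrite /word_perm !big_cons !big_nil !mulg1 /=.
  apply: (perm_onC (tperm_on _ _) (tperm_on _ _)).
  rewrite -setI_eq0; apply/eqP/setP=> x; rewrite !inE.
  case: eqP => [->|_] /=; first by rewrite (negbTE h1) (negbTE h2).
  by case: eqP => [->|_] //=; rewrite (negbTE h3) (negbTE h4).
- move=> i j ij; rewrite /word_perm !big_cons !big_nil !mulg1 /=.
  have E : left_pos j = right_pos i by apply: val_inj.
  have h1 := left_right_neq i; have h2 := left_right_neq j.
  have h3 : left_pos i != right_pos j by rewrite -val_eqE /=; lia.
  rewrite E in h2 *.
  have tJ (x y z t : 'I_N) : (tperm x y * (tperm z t * tperm x y) =
    tperm (tperm x y z) (tperm x y t))%g by rewrite -tpermJ conjgE tpermV.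
  rewrite !tJ tpermR tpermL (tpermD h3 h2).
  by rewrite (@tpermD _ (right_pos i)) // eq_sym.
Qed.

Lemma braid_perm_pi w : braid_perm (\pi_braid w) = word_perm w.
Proof. exact: word_perm_rel (braid_repr_rel w). Qed.

Lemma leg_comm (a b c d : 'I_N) (x y : tpow A 2) :
  a != b -> c != d -> a != c -> a != d -> b != c -> b != d ->
  leg a b x * leg c d y = leg c d y * leg a b x.
Proof.
move=> ab cd ac ad bc bd; apply: place_comm; try exact: tnth2_inj.
move=> p q; rewrite !(tnth_nth a) /=.
by case: p q => [[|[|]]] //= _ [[|[|]]].
Qed.

Lemma YBE_leg (x : tpow A 2) (a b c : 'I_N) :
  YBE x -> a != b -> a != c -> b != c ->
  leg a b x * leg a c x * leg b c x = leg b c x * leg a c x * leg a b x.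
Proof.
move=> xY ab ac bc.
have s_inj := tnth3_inj ab ac bc; set s := tnth _ in s_inj.
have E (i j : 'I_3) : i != j -> leg (s i) (s j) x = place s (leg i j x).
  move=> ij; rewrite /leg place_comp //; last exact: tnth2_inj.
  apply: eq_place => p; rewrite /= !(tnth_nth i) /=.
  by rewrite (tnth_nth (s i)); case: p => [[|[|]]].
have := congr1 (place s) xY; rewrite !placeM //.
by rewrite -!E.
Qed.

Lemma strand_step (p t : 'S_N) x : ((p * t)^-1 x = p^-1 (t^-1 x))%g.
Proof. by rewrite invMg permM. Qed.

Lemma word_invariant_rel v w : YBE (uval R) -> braid_rel v w ->
  forall p, word_invariant p v = word_invariant p w.
Proof.
move=> RY; elim=> {v w} //.
- by move=> u v w _ h1 _ h2 p; rewrite h1 h2.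
- move=> v v' w w' h1 IH1 h2 IH2 p.
  by rewrite !word_invariant_cat IH1 IH2 (word_perm_rel h1).
- move=> b i p /=; rewrite !strand_step !tpermV tpermL tpermR mul1r.
  have qi := perm_inj (s := p^-1%g).
  have ne : (p^-1)%g (left_pos i) != (p^-1)%g (right_pos i).
    by rewrite (inj_eq qi) left_right_neq.
  have inj1 := tnth2_inj ne; rewrite eq_sym in ne; have inj2 := tnth2_inj ne.
  case: b => /=; rewrite /leg -placeM //.
  - by rewrite uinvK place1.
  - by rewrite uvalK place1.
- move=> i j /far_neq[h1 h2 h3 h4] p /=.
  rewrite !strand_step !tpermV !mul1r.
  rewrite !tpermD // 1?eq_sym //.
  by apply: leg_comm; rewrite (inj_eq perm_inj) ?left_right_neq // eq_sym.
- move=> i j ij p /=.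
  have E : left_pos j = right_pos i by apply: val_inj.
  have h1 := left_right_neq i; have h2 := left_right_neq j.
  have h3 : left_pos i != right_pos j by rewrite -val_eqE /=; lia.
  rewrite E in h2 *; have h4 := h1; rewrite eq_sym in h4.
  have h5 := h3; rewrite eq_sym in h5.
  rewrite !strand_step !tpermV !mul1r.
  rewrite !(tpermL, tpermR, tpermD h3 h2, tpermD h4 h5).
  by apply/esym/YBE_leg => //; rewrite (inj_eq perm_inj).
Qed.

Lemma braid_invariant_pi w : YBE (uval R) ->
  braid_invariant (\pi_braid w) = word_invariant 1%g w.
Proof. by move=> RY; apply: word_invariant_rel RY (braid_repr_rel w) _. Qed.

End Braids.

(* sigma_* o x as an operator on A^{(x)N}: multiply by x, then permute        *)
Definition perm_after (k : comPzRingType) (A : algType k) (N : nat)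
    (sigma : 'S_N) (x : tpow A N) : tpow A N -> tpow A N :=
  perm_factors sigma \o *%R x.

(* Main.v *)
Require Import Defs.
From mathcomp Require Import all_boot all_order all_algebra all_fingroup.
From mathcomp Require Import boolp.

Import GRing.Theory.

Local Open Scope ring_scope.

(** On strands, the claim reads
    [Z_twisted = (phi^{sigma 0} (x) ... (x) phi^{sigma (N-1)}) Z g^-1].
    The right-hand side is multiplicative under stacking braids, which reduces
    it to a single crossing of the strands at positions [n] and [n+1].  There,
    since [phi (x) phi] commutes with [R],
    [(phi^{n+1} (x) phi^n) R (phi^-n (x) phi^-(n+1)) =
     (1 (x) phi^-1) R (phi (x) 1)], and similarly for [R^-1]. *)

(** Needed for negative crossings: the twisting condition only mentions [R], and the same
    commutation is required of its inverse. *)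
Lemma comm_invertible (B : pzRingType) (x : B) (y : invertible B) :
  GRing.comm x (uval y) -> GRing.comm x (uinv y).
Proof.
move=> xy; rewrite /GRing.comm -[LHS]mul1r -(uinvK y) -mulrA (mulrA (uval y)).
by rewrite -xy -(mulrA x) uvalK mulr1.
Qed.

Section Twisting.
Context {k : comPzRingType} {A : algType k}.
Implicit Types phi : invertible A.

Lemma tens2X (x y : A) n : tens2 x y ^+ n = tens2 (x ^+ n) (y ^+ n).
Proof.
by elim: n => [|n IH]; rewrite ?expr0 ?tens2_1 // !exprS IH tens2M.
Qed.

Lemma twist_conj_val phi (x : tpow A 2) n :
    GRing.comm (tens2 (uval phi) (uval phi)) x ->
  tens2 (uval phi ^+ n.+1) (uval phi ^+ n) * x *
    tens2 (uinv phi ^+ n) (uinv phi ^+ n.+1) =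
  tens2 1 (uinv phi) * x * tens2 (uval phi) 1.
Proof.
move=> phix.
have -> : tens2 (uval phi ^+ n.+1) (uval phi ^+ n) =
          tens2 1 (uinv phi) * tens2 (uval phi) (uval phi) ^+ n.+1.
  by rewrite tens2X tens2M mul1r [in X in _ = tens2 _ X]exprS mulrA uinvK mul1r.
(* The central power of [phi (x) phi] moves past [x] and meets the inverse powers, leaving
   [phi (x) 1]. *)
rewrite -(mulrA (tens2 _ _)) (commr_sym (commrX _ (commr_sym phix))) -!mulrA.
do 2 congr (_ * _).
by rewrite tens2X tens2M uvalXK exprS -mulrA uvalXK mulr1.
Qed.

Lemma twist_conj_inv phi (x : tpow A 2) n :
    GRing.comm (tens2 (uval phi) (uval phi)) x ->
  tens2 (uval phi ^+ n) (uval phi ^+ n.+1) * x *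
    tens2 (uinv phi ^+ n.+1) (uinv phi ^+ n) =
  tens2 (uinv phi) 1 * x * tens2 1 (uval phi).
Proof.
move=> phix.
have -> : tens2 (uval phi ^+ n) (uval phi ^+ n.+1) =
          tens2 (uinv phi) 1 * tens2 (uval phi) (uval phi) ^+ n.+1.
  by rewrite tens2X tens2M mul1r [in X in _ = tens2 X _]exprS mulrA uinvK mul1r.
rewrite -(mulrA (tens2 _ _)) (commr_sym (commrX _ (commr_sym phix))) -!mulrA.
do 2 congr (_ * _).
by rewrite tens2X tens2M uvalXK exprS -mulrA uvalXK mulr1.
Qed.

(** Outside the image of [s] the placed tensor has factor 1, so [e] and [f] meet there directly and
    must cancel. *)
Lemma place_sandwich m N (s : 'I_m -> 'I_N) (e f : 'I_N -> A) (x : tpow A m) :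
    injective s -> (forall l, (forall p, s p != l) -> e l * f l = 1) ->
  tens e * place s x * tens f = place s (tens (e \o s) * x * tens (f \o s)).
Proof.
move=> s_inj ef; move: x; apply: tens_ext => [c u v|c u v|a].
- by rewrite place_linear // mulrDr mulrDl -scalerAr -scalerAl.
- by rewrite mulrDr mulrDl -scalerAr -scalerAl place_linear.
rewrite !tensM !place_tens // !tensM; apply: eq_tens => l.
case: pickP => [p /eqP <- //|sl]; rewrite mulr1; apply: ef => p.
by rewrite sl.
Qed.

Lemma leg_sandwich N (a b : 'I_N) (e f : 'I_N -> A) (x : tpow A 2) :
    a != b -> (forall l, l != a -> l != b -> e l * f l = 1) ->
  tens e * leg a b x * tens f =
  leg a b (tens2 (e a) (e b) * x * tens2 (f a) (f b)).
Proof.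
move=> ab ef; have tnth2E (h : 'I_N -> A) :
    tens (h \o tnth [tuple a; b]) = tens2 (h a) (h b).
  apply: eq_tens => p; rewrite /= (tnth_nth a) (tnth_nth 0).
  by case: p => [[|[|]]].
rewrite /leg (place_sandwich _ _ _ _ _ _ (tnth2_inj ab)) ?tnth2E // => l sl.
by apply: ef; rewrite eq_sym; [apply: (sl ord0) | apply: (sl ord_max)].
Qed.

(** Strand [j] carries the power given by its current position [p j]; for [p = 1] these are the
    powers in [g]. *)
Definition position_powers {N} (x : A) (p : 'S_N) : tpow A N :=
  tens (fun j => x ^+ p j).

Lemma position_powersVK phi N (p : 'S_N) :
  position_powers (uinv phi) p * position_powers (uval phi) p = 1.
Proof. by rewrite /position_powers tensM; apply: eq_tens => j; apply: uinvXK. Qed.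

Lemma perm_factors_position_powers N (p : 'S_N) (x : A) :
  perm_factors p (position_powers x p) = tens (fun j : 'I_N => x ^+ j).
Proof.
rewrite /perm_factors (place_tens (@perm_inj _ p)); apply: eq_tens => l.
case: pickP => [q /eqP <- //|/(_ (p^-1%g l))].
by rewrite permKV eqxx.
Qed.

Section TwistedInvariant.
Context {N : nat} {R : invertible (tpow A 2)} {phi : invertible A}.
Hypothesis phiR : GRing.comm (tens2 (uval phi) (uval phi)) (uval R).

Lemma crossing_twist b (i : 'I_N.-1) (p : 'S_N) :
  crossing (twist R phi) b (p^-1%g (left_pos i)) (p^-1%g (right_pos i)) =
  position_powers (uval phi) (p * tperm (left_pos i) (right_pos i))%g *
    crossing R b (p^-1%g (left_pos i)) (p^-1%g (right_pos i)) *
    position_powers (uinv phi) p.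
Proof.
set x := p^-1%g _; set y := p^-1%g _.
have xE : p x = left_pos i by rewrite permKV.
have yE : p y = right_pos i by rewrite permKV.
have xy : x != y by rewrite (inj_eq perm_inj) left_right_neq.
(* A strand not in the crossing keeps its position, so its two powers cancel. *)
have off l : l != x -> l != y ->
    uval phi ^+ (p * tperm (left_pos i) (right_pos i))%g l * uinv phi ^+ p l = 1.
  move=> lx ly; rewrite permM -xE -yE tpermD ?uvalXK //.
    by rewrite (inj_eq perm_inj) eq_sym.
  by rewrite (inj_eq perm_inj) eq_sym.
have yx : y != x by rewrite eq_sym.
rewrite /crossing /position_powers; case: b.
  rewrite leg_sandwich // !permM xE yE tpermL tpermR /=.
  by rewrite twist_conj_val.
(* In a negative crossing the overstrand is [y], moving from position [i+1] to [i], so the two legs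
   exchange exponents. *)
rewrite leg_sandwich // => [|l ly lx]; last exact: off.
rewrite !permM xE yE tpermL tpermR /= twist_conj_inv //.
exact: comm_invertible.
Qed.

(** The starting permutation [p] is arbitrary because each letter changes it for the rest of the
    word. *)
Lemma word_invariant_twist (w : braid_word N) (p : 'S_N) :
  word_invariant (twist R phi) p w =
  position_powers (uval phi) (p * word_perm w)%g * word_invariant R p w *
    position_powers (uinv phi) p.
Proof.
elim: w p => [|[b i] w IH] p /=.
  rewrite /word_perm big_nil mulg1 mulr1 /position_powers tensM -tens1.
  by apply: eq_tens => j; rewrite uvalXK.
rewrite IH crossing_twist !mulrA; congr (_ * _ * _).
(* Telescoping: the powers at the positions just above the first crossing cancel. *)
rewrite -(mulrA (_ * _) (position_powers _ _)) position_powersVK mulr1.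
by rewrite /word_perm big_cons mulgA.
Qed.

End TwistedInvariant.

End Twisting.

Theorem theorem2p12 (k : comPzRingType) (A : algType k)
    (R : invertible (tpow A 2)) (kappa phi : invertible A)
    (hXC : XC_structure R kappa) (hphi : twisting R kappa phi)
    (N : nat) (B : braid N) :
  let g := twist_powers phi N in
  perm_after (braid_perm B) (braid_invariant (twist R phi) B) =
  *%R (uval g) \o perm_after (braid_perm B) (braid_invariant R B)
    \o *%R (uinv g).
Proof.
move=> g; case: hphi => _ phiR; apply: funext => x.
have position1 : position_powers (uinv phi) 1 = uinv g.
  by apply: eq_tens => j; rewrite perm1.
rewrite /perm_after /= /braid_invariant (word_invariant_twist phiR) mul1g.
rewrite position1 -/(braid_perm B) -!mulrA /perm_factors.
(* Permuting factors is multiplicative, and it carries the power [sigma j] from factor [j] to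
   position [sigma j], which turns the left powers into [g]. *)
rewrite (placeM (@perm_inj _ (braid_perm B))); congr (_ * _).
exact: perm_factors_position_powers.
Qed.
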